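(* Let $\mathfrak{U}$ be a universe, let $\mathcal{C}$ be a light category, and let $\mathcal{M}$ be a mono-like wide subcategory of $\mathcal{C}$. 1. There exists an $\mathcal{M}$-well-powering $\mathcal{W}$ if and only if $\mathcal{C}$ is $\mathcal{M}$-well-powered. Moreover, an $\mathcal{M}$-well-powering is unique up to unique isomorphism: if $c \mapsto (x_i,f_i)_{i \in I_c}$ and $c \mapsto (x'_j,f'_j)_{j \in I'_c}$ are $\mathcal{M}$-well-powerings, then for each object $c$ of $\mathcal{C}$ there is a unique bijection $\phi_c \colon I_c \to I'_c$ together with a unique family of isomorphisms $h_i \colon x_i \cong x'_{\phi_c(i)}$ $(i \in I_c)$ in $\mathcal{C}$ such that $f'_{\phi_c(i)} \circ h_i = f_i$ for all $i \in I_c$. 2. $\mathcal{M}$ is determined by any $\mathcal{M}$-well-powering $\mathcal{W}$. Explicitly, if $\mathcal{W} \colon c \mapsto ({}^{\circ}U, i_U)_{U \in \mathrm{Sub}(c)}$ is an $\mathcal{M}$-well-powering, then a $\mathcal{C}$-morphism $b \to c$ is in $\mathcal{M}$ if and only if it is of the form $b \xrightarrow{g} {}^{\circ}U \xrightarrow{i_U} c$ for a (necessarily unique) pair $(U,g)$ consisting of $U \in \mathrm{Sub}(c)$ and an isomorphism $g \colon b \cong {}^{\circ}U$ in $\mathcal{C}$.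
   Context: The setting is ZFC. A universe is a set $\mathfrak{U}$ such that: every set in $\mathfrak{U}$ is a subset of $\mathfrak{U}$; $\emptyset \in \mathfrak{U}$; $x,y \in \mathfrak{U}$ implies $\{x,y\} \in \mathfrak{U}$; if $I \in \mathfrak{U}$ and $(A_i)_{i \in I}$ is a family of sets in $\mathfrak{U}$ then $\bigcup_{i\in I}A_i \in \mathfrak{U}$; $A \in \mathfrak{U}$ implies $\mathcal{P}A \in \mathfrak{U}$. (Universes need not contain $\mathbb{N}$.) A set is small when it is an element of $\mathfrak{U}$; a class is a subset of $\mathfrak{U}$. A category consists of a set of objects and a family of homsets (sets) with composition and identities. A category is light when its set of objects is a class and every homset is small. A wide subcategory $\mathcal{M}$ of $\mathcal{C}$ (i.e. one containing all objects) is mono-like when every $\mathcal{M}$-morphism is monic in $\mathcal{C}$, and whenever a composite $a \xrightarrow{f} b \xrightarrow{g} c$ is in $\mathcal{M}$, then so is $f$. For an object $c$ of $\mathcal{C}$, $\mathcal{M}/c$ is the class of pairs $(x,f)$ with $x$ an object of $\mathcal{C}$ and $f \colon x \to c$ an $\mathcal{M}$-morphism, preordered by $(x,f) \sqsubseteq (y,g)$ iff there is a morphism $h \colon x \to y$ with $g \circ h = f$. Write $(x,f) \cong (y,g)$ when $(x,f)\sqsubseteq(y,g)$ and $(y,g)\sqsubseteq(x,f)$; this is an equivalence relation. Quotient classes: fix an assignment $\theta$ of an element $\theta X \in \mathfrak{U}$ to every inhabited class $X$ such that $\theta X \neq \theta Y$ whenever $X \cap Y = \emptyset$ (for instance a choice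 function). For an equivalence relation $R$ on a class $A$, put $[x]^{*}_R = \theta\{y \in A \mid (x,y)\in R\}$ and $A/^{*}R = \{[x]^{*}_R \mid x \in A\}$. Put $\mathrm{Sub}^{*}(c) = (\mathcal{M}/c)/^{*}(\cong)$. $\mathcal{C}$ is $\mathcal{M}$-well-powered when $\mathrm{Sub}^{*}(c)$ is small for every object $c$ of $\mathcal{C}$. For an equivalence relation $R$ on a set $A$, a family of unique $R$-representatives for $A$ is a set $I$ together with a family $(a_i)_{i \in I}$ of elements of $A$ such that for every $a \in A$ there is a unique $i \in I$ with $(a,a_i) \in R$. An $\mathcal{M}$-well-powering $\mathcal{W}$ assigns to each object $c$ of $\mathcal{C}$ a small family (i.e. with small index set) of unique $(\cong)$-representatives for $\mathcal{M}/c$, written $({}^{\circ}U, i_U)_{U \in \mathrm{Sub}(c)}$; so $\mathrm{Sub}(c)$ is a small index set and each $i_U \colon {}^{\circ}U \to c$ is an $\mathcal{M}$-morphism. *)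

(* Defs.v *)
From Stdlib Require Import ssrfun.

Set Implicit Arguments.
Unset Strict Implicit.
Unset Printing Implicit Defensive.

(** The ambient theory is ZFC: everything below lives in an arbitrary structure
    [Z] satisfying the (second-order) ZFC axioms.  The sets that the axioms
    determine uniquely are given by operations. *)
Record ZFC := {
  zset :> Type;
  mem : zset -> zset -> Prop;
  emptyset : zset;
  upair : zset -> zset -> zset;
  union : zset -> zset;
  power : zset -> zset;
  sep : (zset -> Prop) -> zset -> zset;
  repl : (zset -> zset -> Prop) -> zset -> zset;
  extensionality : forall A B, (forall x, mem x A <-> mem x B) -> A = B;
  foundation : forall A x, mem x A ->
    exists y, mem y A /\ forall z, mem z y -> ~ mem z A;
  emptysetE : forall x, ~ mem x emptyset;
  upairE : forall x y z, mem z (upair x y) <-> z = x \/ z = y;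
  unionE : forall A z, mem z (union A) <-> exists B, mem B A /\ mem z B;
  powerE : forall A B, mem B (power A) <-> (forall z, mem z B -> mem z A);
  sepE : forall P A z, mem z (sep P A) <-> mem z A /\ P z;
  replE : forall (R : zset -> zset -> Prop) A,
    (forall x y y', mem x A -> R x y -> R x y' -> y = y') ->
    forall y, mem y (repl R A) <-> exists x, mem x A /\ R x y;
  infinity : exists A, mem emptyset A /\
    forall x, mem x A -> mem (union (upair x (upair x x))) A;
  choice : forall A,
    (forall x, mem x A -> exists y, mem y x) ->
    (forall x y z, mem x A -> mem y A -> mem z x -> mem z y -> x = y) ->
    exists B, forall x, mem x A -> exists! y, mem y x /\ mem y B
}.

Declare Scope zset_scope.
Delimit Scope zset_scope with zset.
Open Scope zset_scope.
Notation "x '∈' A" := (mem x A) (at level 70) : zset_scope.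

Definition subset (Z : ZFC) (A B : Z) : Prop := forall x, x ∈ A -> x ∈ B.
Notation "A '⊆' B" := (subset A B) (at level 70) : zset_scope.

Definition nonempty (Z : ZFC) (A : Z) : Prop := exists x, x ∈ A.

Definition disjoint (Z : ZFC) (A B : Z) : Prop := forall x, ~ (x ∈ A /\ x ∈ B).

(** Kuratowski pair. *)
Definition opair (Z : ZFC) (x y : Z) : Z := upair (upair x x) (upair x y).

(** The type of elements of a set.  A family [(a_i)_{i \in I}] is a function on
    [El I]; by replacement this is the same as a set-theoretic family. *)
Definition El (Z : ZFC) (A : Z) : Type := {x : Z | x ∈ A}.

Definition el_val (Z : ZFC) (A : Z) (x : El A) : Z := proj1_sig x.
Coercion el_val : El >-> zset.

Definition image (Z : ZFC) (f : Z -> Z) (A : Z) : Z :=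
  repl (fun x y => y = f x) A.

(** The set [{ f i | i \in I }]. *)
Definition range (Z : ZFC) (I : Z) (f : El I -> Z) : Z :=
  repl (fun x y => exists i : El I, x = i /\ y = f i) I.

(** Sets that are elements of [U] are small; subsets of [U] are classes. *)
Record is_universe (Z : ZFC) (U : Z) : Prop := {
  universe_trans : forall A, A ∈ U -> A ⊆ U;
  universe_empty : emptyset Z ∈ U;
  universe_upair : forall x y, x ∈ U -> y ∈ U -> upair x y ∈ U;
  universe_union : forall (I : Z) (A : El I -> Z),
    I ∈ U -> (forall i, A i ∈ U) -> union (range A) ∈ U;
  universe_power : forall A, A ∈ U -> power A ∈ U
}.

Record category (Z : ZFC) := {
  obj : Z;
  hom : El obj -> El obj -> Z;
  idm : forall a, El (hom a a);
  comp : forall a b c, El (hom b c) -> El (hom a b) -> El (hom a c);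
  comp_idl : forall a b (f : El (hom a b)), comp (idm b) f = f;
  comp_idr : forall a b (f : El (hom a b)), comp f (idm a) = f;
  comp_assoc : forall a b c d
    (h : El (hom c d)) (g : El (hom b c)) (f : El (hom a b)),
    comp h (comp g f) = comp (comp h g) f
}.

Notation "g '∘' f" := (comp g f) (at level 40, left associativity) : zset_scope.

Definition Ob (Z : ZFC) (C : category Z) : Type := El (obj C).
Definition Hom (Z : ZFC) (C : category Z) (a b : Ob C) : Type := El (hom a b).
Identity Coercion Ob_El : Ob >-> El.
Identity Coercion Hom_El : Hom >-> El.

Definition light (Z : ZFC) (U : Z) (C : category Z) : Prop :=
  obj C ⊆ U /\ forall a b : Ob C, hom a b ∈ U.

Definition monic (Z : ZFC) (C : category Z) (a b : Ob C) (f : Hom a b) : Prop :=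
  forall (x : Ob C) (u v : Hom x a), f ∘ u = f ∘ v -> u = v.

Definition isomorphism (Z : ZFC) (C : category Z) (a b : Ob C) (f : Hom a b) :
    Prop :=
  exists g : Hom b a, g ∘ f = idm a /\ f ∘ g = idm b.

Record wide_subcategory (Z : ZFC) (C : category Z) := {
  mor : forall a b : Ob C, Hom a b -> Prop;
  mor_idm : forall a : Ob C, mor (idm a);
  mor_comp : forall (a b c : Ob C) (g : Hom b c) (f : Hom a b),
    mor g -> mor f -> mor (g ∘ f)
}.

Definition mono_like (Z : ZFC) (C : category Z) (M : wide_subcategory C) :
    Prop :=
  (forall (a b : Ob C) (f : Hom a b), mor M f -> monic f) /\
  (forall (a b c : Ob C) (f : Hom a b) (g : Hom b c),
     mor M (g ∘ f) -> mor M f).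

(** A pair [(x, f)] with [f : x -> c]. *)
Record over (Z : ZFC) (C : category Z) (c : Ob C) := Over {
  src : Ob C;
  arr : Hom src c
}.

Definition over_le (Z : ZFC) (C : category Z) (c : Ob C) (p q : over c) : Prop :=
  exists h : Hom (src p) (src q), arr q ∘ h = arr p.

Definition over_equiv (Z : ZFC) (C : category Z) (c : Ob C) (p q : over c) :
    Prop :=
  over_le p q /\ over_le q p.

Definition over_pair (Z : ZFC) (C : category Z) (c : Ob C) (p : over c) : Z :=
  opair (src p) (arr p).

(** [M/c] as a set of Kuratowski pairs, and [≅] as a relation on it. *)
Definition slice (Z : ZFC) (C : category Z) (M : wide_subcategory C) (c : Ob C) :
    Z :=
  sep (fun s => exists p : over c, mor M (arr p) /\ s = over_pair p)
    (union (range (fun x : Ob C => range (fun f : Hom x c => opair x f)))).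

Definition slice_equiv (Z : ZFC) (C : category Z) (c : Ob C) (s t : Z) : Prop :=
  exists p q : over c, s = over_pair p /\ t = over_pair q /\ over_equiv p q.

(** Only the values of [theta] on inhabited classes matter. *)
Definition quotient_assignment (Z : ZFC) (U : Z) (theta : Z -> Z) : Prop :=
  (forall X, X ⊆ U -> nonempty X -> theta X ∈ U) /\
  (forall X Y, X ⊆ U -> nonempty X -> Y ⊆ U -> nonempty Y ->
     disjoint X Y -> theta X <> theta Y).

(** [[x]*_R] and [A /* R]. *)
Definition star_class (Z : ZFC) (theta : Z -> Z) (A : Z) (R : Z -> Z -> Prop)
    (x : Z) : Z :=
  theta (sep (fun y => R x y) A).

Definition star_quotient (Z : ZFC) (theta : Z -> Z) (A : Z)
    (R : Z -> Z -> Prop) : Z :=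
  image (star_class theta A R) A.

Definition sub_star (Z : ZFC) (theta : Z -> Z) (C : category Z)
    (M : wide_subcategory C) (c : Ob C) : Z :=
  star_quotient theta (slice M c) (slice_equiv c).

Definition well_powered (Z : ZFC) (U : Z) (theta : Z -> Z) (C : category Z)
    (M : wide_subcategory C) : Prop :=
  forall c : Ob C, sub_star theta M c ∈ U.

(** [(a_i)_{i \in I}] is a family of unique [R]-representatives for the subset
    [A] of [T]. *)
Definition unique_representatives (T I : Type) (A : T -> Prop)
    (R : T -> T -> Prop) (a : I -> T) : Prop :=
  (forall i, A (a i)) /\ (forall x, A x -> exists! i, R x (a i)).

(** An assignment to each object [c] of a family of morphisms into [c]; this
    data does not mention [M]. *)
Record over_families (Z : ZFC) (C : category Z) := {
  idx : Ob C -> Z;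
  fam : forall c : Ob C, El (idx c) -> over c
}.

Definition is_well_powering (Z : ZFC) (U : Z) (C : category Z)
    (M : wide_subcategory C) (W : over_families C) : Prop :=
  forall c : Ob C,
    idx W c ∈ U /\
    unique_representatives (fun p : over c => mor M (arr p)) (@over_equiv Z C c)
      (@fam Z C W c).

(** For families [(x_i, f_i)_{i \in I_c}] and [(x'_j, f'_j)_{j \in I'_c}]: a
    function [phi : I_c -> I'_c] with morphisms [h_i : x_i -> x'_(phi i)]. *)
Definition family_map (Z : ZFC) (C : category Z) (W W' : over_families C)
    (c : Ob C) : Type :=
  {phi : El (idx W c) -> El (idx W' c) &
   forall i, Hom (src (fam i)) (src (fam (phi i)))}.

Definition is_family_iso (Z : ZFC) (C : category Z) (W W' : over_families C)
    (c : Ob C) (m : family_map W W' c) : Prop :=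
  let (phi, h) := m in
  bijective phi /\
  (forall i, isomorphism (h i)) /\
  (forall i, arr (fam (phi i)) ∘ h i = arr (fam i)).

(** For [f : b -> c], pairs [(i, g)] with [g] an isomorphism and [f] equal to
    [b --g--> x_i --f_i--> c]. *)
Definition is_factorization (Z : ZFC) (C : category Z) (W : over_families C)
    (b c : Ob C) (f : Hom b c)
    (p : {i : El (idx W c) & Hom b (src (fam i))}) : Prop :=
  let (i, g) := p in isomorphism g /\ arr (fam i) ∘ g = f.

(* Main.v *)
(** A [≅]-equivalence between two monos into [c] is carried by a unique
    isomorphism, by cancellation.  So any two representatives of an equivalence
    class are uniquely isomorphic over [c], which gives the uniqueness of
    well-powerings; and the [M]-morphisms into [c] are exactly the isomorphisms
    followed by representatives, since isomorphisms are in [M].  For existence,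
    [sub_star theta M c] is in bijection with the set of equivalence classes
    because [theta] separates disjoint classes, and it is small as soon as it is
    the range of a family with a small index set. *)

From Stdlib Require Import ssrfun ClassicalEpsilon FunctionalExtensionality.
Require Import Defs.

Set Implicit Arguments.
Unset Strict Implicit.

(** * Elements, ordered pairs and ranges of families *)

Lemma el_val_inj (Z : ZFC) (A : Z) (x y : El A) : el_val x = el_val y -> x = y.
Proof.
  destruct x as [x hx], y as [y hy]; simpl; intros ->.
  now rewrite (proof_irrelevance _ hx hy).
Qed.

Lemma opair_inj (Z : ZFC) (a b c d : Z) :
  opair a b = opair c d -> a = c /\ b = d.
Proof.
  unfold opair; intros E.
  assert (M : forall z, (z = upair a a \/ z = upair a b) <->
                        (z = upair c c \/ z = upair c d)).
  { intros z; rewrite <- !upairE, E; tauto. }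
  assert (S : forall x y z : Z, upair x x = upair y z -> x = y /\ x = z).
  { intros x y z H.
    assert (Hy : y ∈ upair x x) by (rewrite H; apply upairE; auto).
    assert (Hz : z ∈ upair x x) by (rewrite H; apply upairE; auto).
    apply upairE in Hy; apply upairE in Hz; intuition. }
  assert (Eac : a = c).
  { destruct (proj1 (M (upair a a)) (or_introl eq_refl)) as [H | H];
      exact (proj1 (S _ _ _ H)). }
  subst c; split; [reflexivity|].
  (* It remains to compare [b] and [d]: each equals [a] or the other one, so they agree in every
     case. *)
  assert (Hb : b = a \/ b = d).
  { destruct (proj1 (M (upair a b)) (or_intror eq_refl)) as [H | H].
    - symmetry in H; destruct (S _ _ _ H); auto.
    - apply upairE; rewrite <- H; apply upairE; auto. }
  assert (Hd : d = a \/ d = b).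
  { destruct (proj2 (M (upair a d)) (or_intror eq_refl)) as [H | H].
    - symmetry in H; destruct (S _ _ _ H); auto.
    - apply upairE; rewrite <- H; apply upairE; auto. }
  intuition congruence.
Qed.

Lemma rangeE (Z : ZFC) (I : Z) (f : El I -> Z) (y : Z) :
  y ∈ range f <-> exists i : El I, y = f i.
Proof.
  unfold range; rewrite replE.
  - split.
    + intros (x & _ & i & _ & H); eauto.
    + intros (i & H); exists i; split; [exact (proj2_sig i) | eauto].
  - intros x y1 y2 _ (i & Hi & ->) (j & Hj & ->).
    f_equal; apply el_val_inj; congruence.
Qed.

Lemma imageE (Z : ZFC) (f : Z -> Z) (A y : Z) :
  y ∈ image f A <-> exists x, x ∈ A /\ y = f x.
Proof. apply replE; congruence. Qed.

(** The universe axioms speak of unions of small families, so the range is rewritten as the union of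
    the singletons of its values. *)
Lemma range_small (Z : ZFC) (U : Z) (hU : is_universe U) (I : Z)
    (f : El I -> Z) :
  I ∈ U -> (forall i, f i ∈ U) -> range f ∈ U.
Proof.
  intros HI Hf.
  replace (range f) with (union (range (fun i => upair (f i) (f i)))).
  - apply universe_union; auto.
    intros i; apply universe_upair; auto.
  - apply extensionality; intros y; rewrite unionE, rangeE; split.
    + intros (B & HB & Hy); apply rangeE in HB; destruct HB as [i ->].
      apply upairE in Hy; exists i; tauto.
    + intros [i ->]; exists (upair (f i) (f i)); split.
      * apply rangeE; eauto.
      * apply upairE; auto.
Qed.

(** * The preorder on morphisms into a fixed object *)

Lemma over_le_refl (Z : ZFC) (C : category Z) (c : Ob C) (p : over c) :
  over_le p p.
Proof. exists (idm (src p)); apply comp_idr. Qed.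

Lemma over_le_trans (Z : ZFC) (C : category Z) (c : Ob C) (p q r : over c) :
  over_le p q -> over_le q r -> over_le p r.
Proof.
  intros [h Hh] [k Hk]; exists (k ∘ h).
  now rewrite comp_assoc, Hk.
Qed.

Lemma over_equiv_refl (Z : ZFC) (C : category Z) (c : Ob C) (p : over c) :
  over_equiv p p.
Proof. split; apply over_le_refl. Qed.

Lemma over_equiv_sym (Z : ZFC) (C : category Z) (c : Ob C) (p q : over c) :
  over_equiv p q -> over_equiv q p.
Proof. intros []; split; auto. Qed.

Lemma over_equiv_trans (Z : ZFC) (C : category Z) (c : Ob C) (p q r : over c) :
  over_equiv p q -> over_equiv q r -> over_equiv p r.
Proof. intros [] []; split; eapply over_le_trans; eauto. Qed.

(** Homsets may overlap, so an arrow as a bare set need not determine its source; the first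
    component fixes the homset before the arrows are compared. *)
Lemma over_pair_inj (Z : ZFC) (C : category Z) (c : Ob C) (p q : over c) :
  over_pair p = over_pair q -> p = q.
Proof.
  destruct p as [x f], q as [y g]; unfold over_pair; simpl; intros E.
  apply opair_inj in E; destruct E as [Ex Ef].
  apply el_val_inj in Ex; subst y.
  now apply el_val_inj in Ef; subst g.
Qed.

Lemma isomorphism_over_equiv (Z : ZFC) (C : category Z) (c : Ob C)
    (p q : over c) (h : Hom (src p) (src q)) :
  isomorphism h -> arr q ∘ h = arr p -> over_equiv p q.
Proof.
  intros [k [_ Hk]] E; split; [now exists h|exists k].
  now rewrite <- E, <- comp_assoc, Hk, comp_idr.
Qed.

(** Either round trip of the two comparison maps fixes the monic it lies over, and cancelling that
    monic leaves an identity. *)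
Lemma over_equiv_isomorphism (Z : ZFC) (C : category Z) (c : Ob C)
    (p q : over c) :
  monic (arr p) -> monic (arr q) -> over_equiv p q ->
  exists h : Hom (src p) (src q), isomorphism h /\ arr q ∘ h = arr p.
Proof.
  intros mp mq [[h Hh] [k Hk]]; exists h; split; [exists k|exact Hh]; split.
  - apply mp; now rewrite comp_assoc, Hk, Hh, comp_idr.
  - apply mq; now rewrite comp_assoc, Hh, Hk, comp_idr.
Qed.

(** An isomorphism is the first factor of an identity, which lies in [M]. *)
Lemma mono_like_isomorphism (Z : ZFC) (C : category Z)
    (M : wide_subcategory C) (hM : mono_like M) (a b : Ob C) (f : Hom a b) :
  isomorphism f -> mor M f.
Proof.
  intros [g [Hg _]]; apply (proj2 hM _ _ _ f g).
  rewrite Hg; apply mor_idm.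
Qed.

(** * The class of [M]-morphisms into an object and its quotient *)

Lemma sliceE (Z : ZFC) (C : category Z) (M : wide_subcategory C) (c : Ob C)
    (s : Z) :
  s ∈ slice M c <-> exists p : over c, mor M (arr p) /\ s = over_pair p.
Proof.
  unfold slice; rewrite sepE; split; [tauto|].
  intros H; split; [|exact H].
  destruct H as (p & _ & ->); apply unionE.
  exists (range (fun f : Hom (src p) c => opair (src p) f)).
  split; apply rangeE; [exists (src p)|exists (arr p)]; reflexivity.
Qed.

Lemma slice_class (Z : ZFC) (U : Z) (hU : is_universe U) (C : category Z)
    (hC : light U C) (M : wide_subcategory C) (c : Ob C) :
  slice M c ⊆ U.
Proof.
  intros s Hs; apply sliceE in Hs; destruct Hs as (p & _ & ->).
  assert (Hx : el_val (src p) ∈ U) by exact (proj1 hC _ (proj2_sig (src p))).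
  assert (Hf : el_val (arr p) ∈ U)
    by exact (universe_trans hU (proj2 hC _ _) (proj2_sig (arr p))).
  unfold over_pair, opair; repeat apply (universe_upair hU); assumption.
Qed.

Lemma slice_equivE (Z : ZFC) (C : category Z) (c : Ob C) (p q : over c) :
  slice_equiv c (over_pair p) (over_pair q) <-> over_equiv p q.
Proof.
  split.
  - intros (p' & q' & Ep & Eq & E).
    apply over_pair_inj in Ep; apply over_pair_inj in Eq; now subst.
  - intros E; exists p, q; auto.
Qed.

Definition over_class (Z : ZFC) (theta : Z -> Z) (C : category Z)
    (M : wide_subcategory C) (c : Ob C) (p : over c) : Z :=
  star_class theta (slice M c) (slice_equiv c) (over_pair p).

Lemma sub_starE (Z : ZFC) (theta : Z -> Z) (C : category Z)
    (M : wide_subcategory C) (c : Ob C) (y : Z) :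
  y ∈ sub_star theta M c <->
  exists p : over c, mor M (arr p) /\ over_class theta M p = y.
Proof.
  unfold sub_star, star_quotient; rewrite imageE; split.
  - intros (s & Hs & ->); apply sliceE in Hs; destruct Hs as (p & Hp & ->).
    now exists p.
  - intros (p & Hp & <-); exists (over_pair p); split; [|reflexivity].
    apply sliceE; eauto.
Qed.

Section OverClass.

Context (Z : ZFC) (U : Z) (hU : is_universe U).
Context (theta : Z -> Z) (htheta : quotient_assignment U theta).
Context (C : category Z) (hC : light U C) (M : wide_subcategory C) (c : Ob C).

(** By unfolding, [over_class theta M p] is [theta (cls p)], so [htheta] applies to it directly. *)
Let cls (p : over c) : Z := sep (slice_equiv c (over_pair p)) (slice M c).

Local Lemma cls_class (p : over c) : cls p ⊆ U.
Proof.
  intros s Hs; apply sepE in Hs.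
  now apply (slice_class hU hC (M := M) (c := c)).
Qed.

Local Lemma cls_nonempty (p : over c) : mor M (arr p) -> nonempty (cls p).
Proof.
  intros Hp; exists (over_pair p); apply sepE; split.
  - apply sliceE; eauto.
  - apply slice_equivE, over_equiv_refl.
Qed.

Lemma over_class_small (p : over c) :
  mor M (arr p) -> over_class theta M p ∈ U.
Proof. intros Hp; apply htheta; [apply cls_class|now apply cls_nonempty]. Qed.

Lemma over_class_eq (p q : over c) :
  mor M (arr p) -> mor M (arr q) ->
  (over_class theta M p = over_class theta M q <-> over_equiv p q).
Proof.
  intros Hp Hq; split.
  (* If [p] and [q] are inequivalent, their classes are disjoint, since a common member [r] would
     link them; [theta] then separates the classes, against [E]. *)
  - intros E; apply NNPP; intros N.
    refine (proj2 htheta (cls p) (cls q) _ _ _ _ _ E);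
      try apply cls_class; try (apply cls_nonempty; assumption).
    intros s [H1 H2]; apply sepE in H1; apply sepE in H2.
    destruct H1 as [Hs H1], H2 as [_ H2].
    apply sliceE in Hs; destruct Hs as (r & _ & ->).
    apply slice_equivE in H1; apply slice_equivE in H2.
    exact (N (over_equiv_trans H1 (over_equiv_sym H2))).
  - intros E; unfold over_class, star_class; f_equal.
    apply extensionality; intros s; rewrite !sepE, sliceE.
    split; intros [(r & Hr & ->) H]; (split; [eauto|]);
      apply slice_equivE; apply slice_equivE in H.
    + exact (over_equiv_trans (over_equiv_sym E) H).
    + exact (over_equiv_trans E H).
Qed.

End OverClass.

(** * Existence of well-powerings *)

Lemma well_powering_well_powered (Z : ZFC) (U : Z) (hU : is_universe U)
    (theta : Z -> Z) (htheta : quotient_assignment U theta)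
    (C : category Z) (hC : light U C) (M : wide_subcategory C)
    (W : over_families C) :
  is_well_powering U M W -> well_powered U theta M.
Proof.
  intros HW c; destruct (HW c) as (HI & Hm & Hu).
  replace (sub_star theta M c)
    with (range (fun i : El (idx W c) => over_class theta M (fam i))).
  - apply range_small; auto.
    intros i; apply over_class_small with (1 := hU); auto.
  - apply extensionality; intros y; rewrite rangeE, sub_starE; split.
    + intros [i ->]; exists (fam i); auto.
    + intros (p & Hp & <-); destruct (Hu p Hp) as (i & Hi & _); exists i.
      now apply (over_class_eq hU htheta hC); auto.
Qed.

Lemma well_powered_well_powering (Z : ZFC) (U : Z) (hU : is_universe U)
    (theta : Z -> Z) (htheta : quotient_assignment U theta)
    (C : category Z) (hC : light U C) (M : wide_subcategory C) :
  well_powered U theta M ->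
  exists W : over_families C, is_well_powering U M W.
Proof.
  intros HU.
  (* The quotient itself serves as index set: each [y] in it is the value of [theta] on some class,
     and a member of that class is chosen. *)
  pose (rep (c : Ob C) (y : El (sub_star theta M c)) :=
    constructive_indefinite_description _
      (proj1 (sub_starE theta M c y) (proj2_sig y))).
  exists {| idx := sub_star theta M; fam := fun c y => proj1_sig (rep c y) |}.
  intros c; split; [exact (HU c)|simpl; split].
  - intros y; exact (proj1 (proj2_sig (rep c y))).
  - intros p Hp.
    assert (Hy : over_class theta M p ∈ sub_star theta M c)
      by (apply sub_starE; eauto).
    exists (exist (fun y => y ∈ sub_star theta M c) _ Hy); split.
    + destruct (rep c _) as [q [Hq E]]; simpl in *.
      apply over_equiv_sym.
      now apply (over_class_eq hU htheta hC Hq Hp).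
    + intros y; destruct (rep c y) as [q [Hq E]]; simpl; intros Epq.
      apply el_val_inj; simpl; rewrite <- E.
      now apply (over_class_eq hU htheta hC Hp Hq).
Qed.

(** * Uniqueness of well-powerings *)

Lemma well_powering_representative_inj (Z : ZFC) (U : Z) (C : category Z)
    (M : wide_subcategory C) (W : over_families C)
    (hW : is_well_powering U M W) (c : Ob C) (p : over c)
    (i j : El (idx W c)) :
  over_equiv p (fam i) -> over_equiv p (fam j) -> i = j.
Proof.
  intros Hi Hj; destruct (hW c) as (_ & Hm & Hu).
  (* Uniqueness of the index is applied to [fam i], which is known to be in [M]; it is equivalent to
     itself and, through [p], to [fam j]. *)
  destruct (Hu (fam i) (Hm i)) as (k & _ & Hk).
  rewrite <- (Hk i), <- (Hk j); [reflexivity| |apply over_equiv_refl].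
  exact (over_equiv_trans (over_equiv_sym Hi) Hj).
Qed.

Lemma well_powering_representative (Z : ZFC) (U : Z) (C : category Z)
    (M : wide_subcategory C) (hM : mono_like M) (W : over_families C)
    (hW : is_well_powering U M W) (c : Ob C) (p : over c) :
  mor M (arr p) ->
  exists (i : El (idx W c)) (h : Hom (src p) (src (fam i))),
    isomorphism h /\ arr (fam i) ∘ h = arr p.
Proof.
  intros Hp; destruct (hW c) as (_ & Hm & Hu).
  destruct (Hu p Hp) as (i & Hi & _); exists i.
  apply over_equiv_isomorphism; auto; apply hM; auto.
Qed.

Lemma family_iso_unique (Z : ZFC) (U : Z) (C : category Z)
    (M : wide_subcategory C) (hM : mono_like M) (W W' : over_families C)
    (hW' : is_well_powering U M W') (c : Ob C) (m m' : family_map W W' c) :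
  is_family_iso m -> is_family_iso m' -> m = m'.
Proof.
  destruct m as [phi h], m' as [phi' h'].
  intros (_ & Hi & E) (_ & Hi' & E').
  (* The type of [h] depends on [phi], so the index maps are identified first; only then can the
     arrows be compared and the monic cancelled. *)
  assert (phi = phi') as <-.
  { apply functional_extensionality; intros i.
    apply (well_powering_representative_inj hW' (p := fam i)).
    - exact (isomorphism_over_equiv (Hi i) (E i)).
    - exact (isomorphism_over_equiv (Hi' i) (E' i)). }
  f_equal; apply functional_extensionality_dep; intros i.
  apply (proj1 hM _ _ (arr (fam (phi i)))); [apply hW'|].
  now rewrite E, E'.
Qed.

Lemma family_iso_exists (Z : ZFC) (U : Z) (C : category Z)
    (M : wide_subcategory C) (hM : mono_like M) (W W' : over_families C)
    (hW : is_well_powering U M W) (hW' : is_well_powering U M W') (c : Ob C) :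
  exists m : family_map W W' c, is_family_iso m.
Proof.
  pose (rep i := constructive_indefinite_description _
    (well_powering_representative hM hW' (proj1 (proj2 (hW c)) i))).
  pose (rep' j := constructive_indefinite_description _
    (well_powering_representative hM hW (proj1 (proj2 (hW' c)) j))).
  pose (iso i := constructive_indefinite_description _ (proj2_sig (rep i))).
  exists (existT
    (fun phi : El (idx W c) -> El (idx W' c) =>
       forall i, Hom (src (fam i)) (src (fam (phi i))))
    (fun i => proj1_sig (rep i)) (fun i => proj1_sig (iso i))).
  assert (R : forall i, over_equiv (fam i) (fam (proj1_sig (rep i)))).
  { intros i; destruct (proj2_sig (rep i)) as (h & Hh & E).
    exact (isomorphism_over_equiv Hh E). }
  assert (R' : forall j, over_equiv (fam j) (fam (proj1_sig (rep' j)))).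
  { intros j; destruct (proj2_sig (rep' j)) as (h & Hh & E).
    exact (isomorphism_over_equiv Hh E). }
  (* The choices in the two directions are independent, yet inverse on indices: going there and back
     stays within one equivalence class, which has a single index. *)
  split; [exists (fun j => proj1_sig (rep' j))|split].
  - intros i; apply (well_powering_representative_inj hW (p := fam i)).
    + exact (over_equiv_trans (R i) (R' _)).
    + apply over_equiv_refl.
  - intros j; apply (well_powering_representative_inj hW' (p := fam j)).
    + exact (over_equiv_trans (R' j) (R _)).
    + apply over_equiv_refl.
  - intros i; exact (proj1 (proj2_sig (iso i))).
  - intros i; exact (proj2 (proj2_sig (iso i))).
Qed.

(** * Recovering [M] from a well-powering *)

Lemma well_powering_mor (Z : ZFC) (U : Z) (C : category Z)
    (M : wide_subcategory C) (hM : mono_like M) (W : over_families C)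
    (hW : is_well_powering U M W) (b c : Ob C) (f : Hom b c) :
  mor M f <->
  exists p : {i : El (idx W c) & Hom b (src (fam i))}, is_factorization f p.
Proof.
  split.
  - intros Hf.
    destruct (well_powering_representative hM hW (p := Over f) Hf)
      as (i & h & Hh).
    now exists (existT (fun i : El (idx W c) => Hom b (src (fam i))) i h).
  - intros [[i g] [Hg <-]].
    apply mor_comp; [apply hW|now apply mono_like_isomorphism].
Qed.

Lemma factorization_unique (Z : ZFC) (U : Z) (C : category Z)
    (M : wide_subcategory C) (hM : mono_like M) (W : over_families C)
    (hW : is_well_powering U M W) (b c : Ob C) (f : Hom b c) :
  uniqueness (fun p : {i : El (idx W c) & Hom b (src (fam i))} =>
    is_factorization f p).
Proof.
  intros [i g] [j k] [Hg Eg] [Hk Ek].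
  (* Both factorizations exhibit [f] as equivalent to a representative, so the indices agree. *)
  assert (i = j) as <-.
  { apply (well_powering_representative_inj hW (p := Over f)).
    - exact (isomorphism_over_equiv (p := Over f) Hg Eg).
    - exact (isomorphism_over_equiv (p := Over f) Hk Ek). }
  f_equal; apply (proj1 hM _ _ (arr (fam i))); [apply hW|congruence].
Qed.

Theorem proposition4 (Z : ZFC) (U : Z) (hU : is_universe U)
    (theta : Z -> Z) (htheta : quotient_assignment U theta)
    (C : category Z) (hC : light U C)
    (M : wide_subcategory C) (hM : mono_like M) :
  (((exists W : over_families C, is_well_powering U M W) <->
      well_powered U theta M) /\
   (forall W W' : over_families C,
      is_well_powering U M W -> is_well_powering U M W' ->
      forall c : Ob C,
        exists! m : family_map W W' c, is_family_iso m)) /\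
  (forall W : over_families C, is_well_powering U M W ->
     (forall M' : wide_subcategory C,
        mono_like M' -> is_well_powering U M' W ->
        forall (b c : Ob C) (f : Hom b c), mor M f <-> mor M' f) /\
     (forall (b c : Ob C) (f : Hom b c),
        (mor M f <->
           exists p : {i : El (idx W c) & Hom b (src (fam i))},
             is_factorization f p) /\
        uniqueness
          (fun p : {i : El (idx W c) & Hom b (src (fam i))} =>
             is_factorization f p))).
Proof.
  (* In the second half, the inner [split] also introduces [W] and its well-powering hypothesis,
     under the name [H]. *)
  split; split.
  - split.
    + intros [W hW]; exact (well_powering_well_powered hU htheta hC hW).
    + exact (well_powered_well_powering hU htheta hC (M := M)).
  - intros W W' hW hW' c.
    destruct (family_iso_exists hM hW hW' c) as [m Hm]; exists m.
    split; [exact Hm|intros m' Hm'].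
    exact (family_iso_unique hM hW' Hm Hm').
  - intros M' hM' hW' b c f.
    (* The factorization criterion mentions only [W], so it is the same condition for [M] and
       [M']. *)
    now rewrite (well_powering_mor hM H f), (well_powering_mor hM' hW' f).
  - intros b c f; split.
    + exact (well_powering_mor hM H f).
    + exact (factorization_unique hM H (f := f)).
Qed.
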